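(* Let $n$ be a positive integer and let $F:\mathbb{C}[x_1,\ldots,x_n]\to\mathbb{C}[x_1,\ldots,x_n]$ be a $\mathbb{C}$-algebra endomorphism that has an invertible Jacobian; write $F_i=F(x_i)$. If there exists a subset $A\subset\{1,\ldots,n\}$ of cardinality $n-1$ such that for every $j\in A$ the minimal polynomial of $x_j$ over $\mathbb{C}(F_1,\ldots,F_n)$ has degree $d_j\le 2$, then $F$ is an automorphism.
   Context: $F$ has an invertible Jacobian means $\operatorname{Jac}(F_1,\ldots,F_n)=\det(\partial F_i/\partial x_j)\in\mathbb{C}^*$. The field $\mathbb{C}(F_1,\ldots,F_n)$ is regarded as a subfield of $\mathbb{C}(x_1,\ldots,x_n)$. *)

(* Defs.v *)
From HB Require Import structures.
From mathcomp Require Import all_boot all_order all_algebra.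
From mathcomp Require Import fraction mpoly complex.
From mathcomp Require Import reals.

Set Implicit Arguments.
Unset Strict Implicit.
Unset Printing Implicit Defensive.

Import GRing.Theory.

Local Open Scope ring_scope.

(* The subfield of L generated by S; it contains 0 = 1 - 1 and, since z / 0 = 0
   in L, closure under division needs no side condition. *)
Inductive generated_subfield (L : fieldType) (S : L -> Prop) : L -> Prop :=
| gen_mem z : S z -> generated_subfield S z
| gen_one : generated_subfield S 1
| gen_sub y z : generated_subfield S y -> generated_subfield S z ->
    generated_subfield S (y - z)
| gen_div y z : generated_subfield S y -> generated_subfield S z ->
    generated_subfield S (y / z).

(* [minPoly] of fieldext.v needs a finite-dimensional extension of a fieldType
   and a detachable subfield, neither of which is available for C(F) in C(x). *)
Definition is_minimal_polynomial (L : fieldType) (K : L -> Prop) (a : L)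
    (p : {poly L}) : Prop :=
  [/\ p \is monic,
      forall k, K p`_k,
      root p a
    & forall q : {poly L}, q != 0 -> (forall k, K q`_k) -> root q a ->
        (size p <= size q)%N].

Section PolynomialEndomorphisms.

Variables (C : fieldType) (n : nat).

Implicit Type F : {lrmorphism {mpoly C[n]} -> {mpoly C[n]}}.

Definition ratfrac := {fraction {mpoly C[n]}}.

Definition to_ratfrac (p : {mpoly C[n]}) : ratfrac := @FracField.tofrac _ p.

Definition image_field F : ratfrac -> Prop :=
  generated_subfield (fun z : ratfrac =>
    (exists c : C, z = to_ratfrac c%:MP) \/
    (exists i : 'I_n, z = to_ratfrac (F 'X_i))).

Definition jacobian F : {mpoly C[n]} :=
  \det (\matrix_(i < n, j < n) mderiv j (F 'X_i)).

Definition invertible_jacobian F : Prop :=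
  exists2 c : C, c != 0 & jacobian F = c%:MP.

End PolynomialEndomorphisms.

(* Main.v *)
Require Import Defs.
From HB Require Import structures.
From mathcomp Require Import all_boot all_order all_algebra.
From mathcomp Require Import fraction mpoly complex.
From mathcomp Require Import reals boolp ring.

Import GRing.Theory.

Local Open Scope ring_scope.

(* The derivations d/dF_j extend to C[x] because the Jacobian matrix is
   invertible. If q is a prime of C[x] whose contraction P to C[F] is nonzero,
   they show that P is principal, generated by a prime p that q divides exactly
   once in C[x]. Hence C(F) meets C[x] in C[F], and an element of C[x] whose
   square lies in C[F] lies in C[F]. So if x_j has degree at most 2 over C(F),
   the square root of the discriminant, and then x_j itself, lies in C[F].
   If this holds for all j except i, Cramer's rule shows that C[F] is stable
   under d/dx_i; as this derivation is locally nilpotent, C[F] contains some y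
   whose derivative a is a nonzero constant of d/dx_i. Then y - a x_i, being a
   polynomial in the other variables, lies in C[F], and so does x_i. *)

(** * Unique factorization *)

Definition divides {R : comNzRingType} (a b : R) : Prop := exists c, b = a * c.

Lemma divides_mulr {R : comNzRingType} (d a b : R) :
  divides d a -> divides d (a * b).
Proof. by case=> c ->; exists (c * b); rewrite mulrA. Qed.

Lemma divides_mull {R : comNzRingType} (d a b : R) :
  divides d b -> divides d (a * b).
Proof. by rewrite mulrC; apply: divides_mulr. Qed.

Lemma dividesD {R : comNzRingType} (d a b : R) :
  divides d a -> divides d b -> divides d (a + b).
Proof. by case=> u -> [v ->]; exists (u + v); rewrite mulrDr. Qed.

Lemma dividesN {R : comNzRingType} (d a : R) : divides d a -> divides d (- a).
Proof. by case=> u ->; exists (- u); rewrite mulrN. Qed.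

Lemma dividesB {R : comNzRingType} (d a b : R) :
  divides d a -> divides d b -> divides d (a - b).
Proof. by move=> da db; apply: dividesD => //; apply: dividesN. Qed.

Lemma divides_trans {R : comNzRingType} (a b c : R) :
  divides a b -> divides b c -> divides a c.
Proof. by move=> ab [d ->]; apply: divides_mulr. Qed.

Definition prime_element {R : idomainType} (p : R) : Prop :=
  [/\ p != 0, p \isn't a GRing.unit
    & forall a b, divides p (a * b) -> divides p a \/ divides p b].

Inductive prime_product {R : idomainType} : R -> Prop :=
| prime_product_unit u : u \is a GRing.unit -> prime_product u
| prime_product_cons p a : prime_element p -> prime_product a ->
    prime_product (p * a).

(** Primality of the factors forces uniqueness up to units, so existence alone characterizes unique
    factorization domains. *)
Definition factorial_ring (R : idomainType) : Prop :=
  forall a : R, a != 0 -> prime_product a.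

Lemma divides_unit {R : idomainType} (a b : R) :
  divides a b -> b \is a GRing.unit -> a \is a GRing.unit.
Proof. by case=> c ->; rewrite unitrM => /andP[]. Qed.

Lemma prime_productM {R : idomainType} (a b : R) :
  prime_product a -> prime_product b -> prime_product (a * b).
Proof.
move=> + pb; elim=> [u uu|p c pp _ IH]; last first.
  by rewrite -mulrA; apply: prime_product_cons.
elim: pb => [v vu|p c pp _ IH].
  by apply: prime_product_unit; rewrite unitrM uu.
by rewrite mulrCA; apply: prime_product_cons.
Qed.

Lemma factorial_ring_iso (R S : idomainType) (f : {rmorphism R -> S})
    (g : {rmorphism S -> R}) :
  cancel f g -> cancel g f -> factorial_ring R -> factorial_ring S.
Proof.
move=> fK gK UR.
have prime_f p : prime_element p -> prime_element (f p).
  case=> p0 pu pP; split.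
  - by rewrite -(rmorph0 f) (can_eq fK).
  - apply: contra pu => /(rmorph_unit g); rewrite fK; exact.
  move=> a b [c abE].
  have : divides p (g a * g b).
    by exists (g c); rewrite -rmorphM abE rmorphM fK.
  case/pP=> -[d dE]; [left|right]; exists (f d);
    by rewrite -rmorphM -dE gK.
move=> a a0; rewrite -[a]gK.
have : g a != 0 by rewrite -(rmorph0 g) (can_eq gK).
move/UR; elim=> [u uu|p c pp _ IH].
  by apply: prime_product_unit; apply: rmorph_unit.
by rewrite rmorphM; apply: prime_product_cons => //; apply: prime_f.
Qed.

(** * Gauss's lemma and unique factorization in [{poly R}] *)

Section Gauss.

Variable R : idomainType.
Implicit Types (a b f g : {poly R}) (c p : R).

(** For nonzero [f] over a factorial ring this means unit content, expressed without gcds of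
    coefficients. *)
Definition primitive f := forall p, prime_element p -> ~ divides p%:P f.

Lemma dividesMX p f : p != 0 -> divides p%:P (f * 'X) -> divides p%:P f.
Proof.
move=> p0 [u fX].
have u0 : u`_0 = 0.
  have /eqP := congr1 (coefp 0) fX.
  by rewrite /= coefMX coefCM /= eq_sym mulf_eq0 (negPf p0) => /eqP.
exists (drop_poly 1 u); apply: (mulIf (negbT (polyX_eq0 R))); rewrite fX -mulrA.
congr (_ * _); rewrite -{1}[u](poly_take_drop 1) expr1.
suff -> : take_poly 1 u = 0 by rewrite add0r.
by apply/polyP=> -[|i]; rewrite coef_take_poly coef0.
Qed.

(** Induction on the total size: [p] divides the product of the constant coefficients, hence one of
    them. Subtracting that one from its factor and cancelling ['X] leaves a shorter factor. *)
Lemma prime_elementC p : prime_element p -> prime_element p%:P.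
Proof.
case=> p0 pu pP; split; first by rewrite polyC_eq0.
  by rewrite poly_unitE size_polyC p0 coefC.
move=> a b; move: {2}(_ + _)%N (leqnn (size a + size b)) => n.
elim: n a b => [|n IHn] a b.
  rewrite leqn0 addn_eq0 !size_poly_eq0 => /andP[/eqP-> _] _.
  by left; exists 0; rewrite mulr0.
elim/poly_ind: a => [|a a0 _]; first by left; exists 0; rewrite mulr0.
elim/poly_ind: b => [|b b0 _]; first by right; exists 0; rewrite mulr0.
move=> szab dab.
have sMX (r : {poly R}) r0 : (size r <= size (r * 'X + r0%:P)%R)%N.
  by rewrite size_MXaddC; case: ifP => [/andP[/eqP-> _]|//]; rewrite size_poly0.
have sMX1 (r : {poly R}) r0 : r != 0 -> (size r < size (r * 'X + r0%:P)%R)%N.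
  by rewrite size_MXaddC => /negPf->.
have : divides p (a0 * b0).
  case: dab => u /(congr1 (coefp 0)) /=.
  by rewrite coef0M coefCM !coefD !coefMX !coefC /= !add0r => ->; exists u`_0.
case/pP=> -[c cE].
  have dc : divides p%:P a0%:P by exists c%:P; rewrite cE polyCM.
  have /(dividesMX _ _ p0) dab' : divides p%:P (a * (b * 'X + b0%:P) * 'X).
    rewrite [X in divides _ X](_ : _ = (a * 'X + a0%:P) * (b * 'X + b0%:P)
      - a0%:P * (b * 'X + b0%:P)); last by rewrite mulrDl addrK mulrAC.
    by apply: dividesB => //; apply: divides_mulr.
  have [a_eq0|a_neq0] := eqVneq a 0.
    by left; rewrite a_eq0 mul0r add0r.
  have [||d] := IHn _ _ _ dab'; [|by left; apply: dividesD=> //; apply: divides_mulr|by right].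
  by rewrite -ltnS; apply: leq_trans szab; rewrite -addSn leq_add2r sMX1.
have dc : divides p%:P b0%:P by exists c%:P; rewrite cE polyCM.
have /(dividesMX _ _ p0) dab' : divides p%:P ((a * 'X + a0%:P) * b * 'X).
  rewrite [X in divides _ X](_ : _ = (a * 'X + a0%:P) * (b * 'X + b0%:P)
    - (a * 'X + a0%:P) * b0%:P); last by rewrite mulrDr addrK mulrA.
  by apply: dividesB => //; apply: divides_mull.
have [b_eq0|b_neq0] := eqVneq b 0.
  by right; rewrite b_eq0 mul0r add0r.
have [||d] := IHn _ _ _ dab'; [|by left|by right; apply: dividesD=> //; apply: divides_mulr].
by rewrite -ltnS; apply: leq_trans szab; rewrite -addnS leq_add2l sMX1.
Qed.

Lemma prime_productC c : prime_product c -> prime_product c%:P.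
Proof.
elim=> [u uu|p a pp _ IH].
  by apply: prime_product_unit; rewrite rmorph_unit.
by rewrite polyCM; apply: prime_product_cons => //; apply: prime_elementC.
Qed.

(** Each prime factor of [c] divides [f * w] but not [f], so it divides the cofactor [w] and
    cancels. *)
Lemma primitive_divides f a c : primitive f -> prime_product c ->
  divides f (c%:P * a) -> divides f a.
Proof.
move=> fP; elim=> [u uu|p d pp _ IH].
  by move/(divides_mull _ u^-1%:P); rewrite mulrA -polyCM mulVr // mul1r.
case=> w; rewrite polyCM -mulrA => E.
have : divides p%:P (f * w) by rewrite -E; exists (d%:P * a).
case: (prime_elementC _ pp) => p0 _ /[apply] -[/(fP _ pp) //|[v vE]].
by apply: IH; exists v; apply: (mulfI p0); rewrite E vE mulrCA.
Qed.

Hypothesis UR : factorial_ring R.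

Lemma primitive_part f : f != 0 ->
  exists c f1, [/\ c != 0, primitive f1 & f = c%:P * f1].
Proof.
move=> f0.
have : forall c, divides c%:P f -> divides c (lead_coef f).
  by move=> c [u ->]; exists (lead_coef u); rewrite lead_coefM lead_coefC.
have : prime_product (lead_coef f) by apply: UR; rewrite lead_coef_eq0.
(* The leading coefficient becomes any factored [l] that is divisible by every constant dividing
   [f]. A prime of [l] is either extracted from [f] or dropped from [l]; both shorten the
   factorization of [l]. *)
move: (lead_coef f) => l H; elim: H f {f0} => [u uu|p a pp _ IH] f Hf.
  exists 1, f; rewrite oner_neq0 mul1r; split=> // p [_ + _] /Hf pu.
  by rewrite (divides_unit _ _ pu).
have p0 : p != 0 by case: pp.
have [[g gE]|npf] := pselect (divides p%:P f).
  have [c [g1 [c0 g1P E]]] : exists c g1, [/\ c != 0, primitive g1 & g = c%:P * g1].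
    apply: IH => c [h hE].
    have [|e eE] := Hf (p * c).
      by exists h; rewrite gE hE polyCM mulrA.
    by exists e; apply: (mulfI p0); rewrite eE mulrA.
  by exists (p * c), g1; rewrite mulf_neq0 // gE E polyCM mulrA.
apply: IH => c cf; have [e eE] := Hf _ cf.
case: (pp) => _ _ /(_ c e); rewrite -eE.
case; [by exists a|move=> [d dE]|move=> [d dE]].
  by case: npf; apply: divides_trans cf; exists d%:P; rewrite dE polyCM.
by exists d; apply: (mulfI p0); rewrite eE dE mulrCA.
Qed.

(** Over a domain [%|] permits a nonzero scalar on the dividend, so it is divisibility over the
    fraction field; primitivity removes the scalar. *)
Lemma dvdp_divides f a : primitive f -> f %| a -> divides f a.
Proof.
move=> fP /Pdiv.Idomain.dvdpP [[c u] /= c0 E].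
apply: (primitive_divides _ _ _ fP (UR _ c0)).
by exists u; rewrite mul_polyC E mulrC.
Qed.

(** Irreducibility is meant over the fraction field, where coprimality arguments apply;
    [dvdp_divides] brings the resulting divisibility back to [{poly R}]. *)
Lemma prime_element_irredp f : primitive f -> irreducible_poly f ->
  prime_element f.
Proof.
move=> fP [sf firr]; split; first by rewrite -size_poly_gt0 ltnW.
  by rewrite poly_unitE; case: eqP sf => // ->.
move=> a b [c abE].
have : f %| a * b by rewrite abE dvdp_mulr.
have [cfb|ncfb] := boolP (coprimep f b).
  by rewrite Gauss_dvdpl // => /(dvdp_divides _ _ fP); left.
move=> _; right; apply: dvdp_divides => //.
have /firr : size (gcdp f b) != 1 by rewrite -coprimep_def.
by move=> /(_ (dvdp_gcdl _ _)) /eqp_dvdl <-; apply: dvdp_gcdr.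
Qed.

Lemma factorial_ring_poly : factorial_ring {poly R}.
Proof.
move=> f; move: {2}(size f) (leqnn (size f)) => n.
elim: n f => [|n IHn] f; first by rewrite leqn0 size_poly_eq0 => ->.
move=> szf f0; have [c [g [c0 gP fE]]] := primitive_part _ f0.
have g0 : g != 0 by apply: contraNneq f0 => g0; rewrite fE g0 mulr0.
rewrite fE in szf *; apply: prime_productM; first exact/prime_productC/UR.
rewrite mul_polyC size_scale // in szf.
have [firr|] := pselect (irreducible_poly g).
  rewrite -[g]mulr1; apply: prime_product_cons; first exact: prime_element_irredp.
  by apply: prime_product_unit; rewrite unitr1.
have [sg _|sg nirr] := leqP (size g) 1.
  have gE := size1_polyC sg.
  by rewrite gE; apply/prime_productC/UR; rewrite -polyC_eq0 -gE.
have [h [h1 hg hgE]] : exists h : {poly R}, [/\ size h != 1, h %| g & ~ h %= g].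
  apply: contrapT => nh; apply: nirr; split=> // h h1 hg.
  by apply: contrapT => nhg; apply: nh; exists h.
have h0 : h != 0 by apply: dvdpN0 hg g0.
have szh : (1 < size h)%N by rewrite ltn_neqAle eq_sym h1 size_poly_gt0.
have szhg : (size h < size g)%N.
  rewrite ltn_neqAle dvdp_leq // andbT.
  by apply/negP; rewrite dvdp_size_eqp.
(* [h] divides [g] only over the fraction field; its primitive part [k], of the same size, divides
   [g] in [{poly R}]. *)
have [d [k [d0 kP hE]]] := primitive_part _ h0.
have szk : size k = size h by rewrite hE mul_polyC size_scale.
have [w gE] : divides k g.
  by apply: dvdp_divides => //; rewrite -(dvdpZl _ _ d0) -mul_polyC -hE.
have k0 : k != 0 by rewrite -size_poly_gt0 szk ltnW.
have w0 : w != 0 by apply: contraNneq g0 => w0; rewrite gE w0 mulr0.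
have szkw := size_mul k0 w0; rewrite -gE szk in szkw.
rewrite gE; apply: prime_productM; apply: IHn => //.
  by rewrite szk -ltnS (leq_trans szhg).
rewrite -ltnS; apply: leq_trans szf; rewrite szkw.
by case: (size h) szh => [|[|s]] // _; rewrite addSn /= -{1}[size w]add0n ltn_add2r.
Qed.

End Gauss.

(** * Polynomials in several variables *)

Lemma mpoly_alg_ind (n : nat) (C : fieldType) (P : {mpoly C[n]} -> Prop) :
  (forall c, P c%:MP) -> (forall i, P 'X_i) ->
  (forall p q, P p -> P q -> P (p + q)) ->
  (forall p q, P p -> P q -> P (p * q)) -> forall p, P p.
Proof.
move=> PC PX PD PM p; rewrite [p]mpolyE; apply: big_ind => //.
  by rewrite -mpolyC0; apply: PC.
move=> m _; rewrite -mul_mpolyC; apply: (PM) => //.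
rewrite mpolyXE_id; apply: big_ind; [exact: PC 1|exact: PM|].
by move=> i _; elim: (m i) => [|k IHk]; [exact: PC 1 | rewrite exprS; apply: (PM)].
Qed.

Lemma mderivXU (n : nat) (C : fieldType) (i j : 'I_n) :
  ('X_j)^`M(i) = (j == i)%:R :> {mpoly C[n]}.
Proof.
rewrite mderivX mnm1E; case: eqVneq => [->|_]; last exact: scale0r.
rewrite scale1r (_ : (U_(i) - U_(i))%MM = 0%MM) ?mpolyX0 //.
by apply/mnmP=> k; rewrite mnmBE subnn mnm0E.
Qed.

(** Both sides are derivations along [phi] that vanish on constants and agree on the variables. *)
Lemma chain_rule (n : nat) (C : fieldType) (S : comNzRingType)
    (phi : {rmorphism {mpoly C[n]} -> S}) (d : S -> S) :
  (forall a b, d (a + b) = d a + d b) ->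
  (forall a b, d (a * b) = d a * b + a * d b) ->
  (forall c, d (phi c%:MP) = 0) ->
  forall p, d (phi p) = \sum_i phi p^`M(i) * d (phi 'X_i).
Proof.
move=> dD dM dC; apply: mpoly_alg_ind => [c|i|p q IHp IHq|p q IHp IHq].
- by rewrite dC big1 // => i _; rewrite mderivC rmorph0 mul0r.
- rewrite (bigD1 i) //= big1 => [|j ji].
    by rewrite mderivXU eqxx rmorph1 mul1r addr0.
  by rewrite mderivXU eq_sym (negPf ji) rmorph0 mul0r.
- rewrite rmorphD dD IHp IHq -big_split; apply: eq_bigr => i _.
  by rewrite mderivD rmorphD mulrDl.
rewrite rmorphM dM IHp IHq mulr_suml mulr_sumr -big_split.
apply: eq_bigr => i _; rewrite mderivM rmorphD !rmorphM mulrDl /=.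
by rewrite mulrAC !mulrA.
Qed.

(** * Isolating one variable: polynomials in it over the polynomials in the others *)

Section MainVariable.

Variables (C : fieldType) (n : nat) (i : 'I_n.+1).

Definition poly_of_mpoly : {mpoly C[n.+1]} -> {poly {mpoly C[n]}} :=
  mmap (polyC \o @mpolyC n C)
    (fun j => oapp (fun k => ('X_k)%:P) 'X (unlift i j)).

HB.instance Definition _ := GRing.RMorphism.on poly_of_mpoly.

Definition mpoly_lift : {mpoly C[n]} -> {mpoly C[n.+1]} :=
  mmap (@mpolyC n.+1 C) (fun k => 'X_(lift i k)).

HB.instance Definition _ := GRing.RMorphism.on mpoly_lift.

Definition mpoly_of_poly : {poly {mpoly C[n]}} -> {mpoly C[n.+1]} :=
  horner_eval 'X_i \o map_poly mpoly_lift.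

HB.instance Definition _ := GRing.RMorphism.on mpoly_of_poly.

Lemma poly_of_mpolyD (p q : {mpoly C[n.+1]}) :
  poly_of_mpoly (p + q) = poly_of_mpoly p + poly_of_mpoly q.
Proof. exact: rmorphD. Qed.

Lemma poly_of_mpolyM (p q : {mpoly C[n.+1]}) :
  poly_of_mpoly (p * q) = poly_of_mpoly p * poly_of_mpoly q.
Proof. exact: rmorphM. Qed.

Lemma mpoly_liftD (p q : {mpoly C[n]}) :
  mpoly_lift (p + q) = mpoly_lift p + mpoly_lift q.
Proof. exact: rmorphD. Qed.

Lemma mpoly_liftM (p q : {mpoly C[n]}) :
  mpoly_lift (p * q) = mpoly_lift p * mpoly_lift q.
Proof. exact: rmorphM. Qed.

Lemma mpoly_of_polyD (p q : {poly {mpoly C[n]}}) :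
  mpoly_of_poly (p + q) = mpoly_of_poly p + mpoly_of_poly q.
Proof. exact: rmorphD. Qed.

Lemma mpoly_of_polyM (p q : {poly {mpoly C[n]}}) :
  mpoly_of_poly (p * q) = mpoly_of_poly p * mpoly_of_poly q.
Proof. exact: rmorphM. Qed.

Lemma mpoly_of_polyC a : mpoly_of_poly a%:P = mpoly_lift a.
Proof. by rewrite /mpoly_of_poly /= /horner_eval map_polyC hornerC. Qed.

Lemma mpoly_of_polyX : mpoly_of_poly 'X = 'X_i.
Proof. by rewrite /mpoly_of_poly /= /horner_eval map_polyX hornerX. Qed.

Lemma poly_of_mpolyC c : poly_of_mpoly c%:MP = (c%:MP)%:P.
Proof. by rewrite [LHS]mmapC. Qed.

Lemma poly_of_mpolyX j :
  poly_of_mpoly 'X_j = oapp (fun k => ('X_k)%:P) 'X (unlift i j).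
Proof. by rewrite [LHS]mmapX mmap1U. Qed.

Lemma mpoly_liftC c : mpoly_lift c%:MP = c%:MP.
Proof. by rewrite [LHS]mmapC. Qed.

Lemma mpoly_liftX k : mpoly_lift 'X_k = 'X_(lift i k).
Proof. by rewrite [LHS]mmapX mmap1U. Qed.

Lemma poly_of_mpolyK : cancel poly_of_mpoly mpoly_of_poly.
Proof.
apply: mpoly_alg_ind => [c|j|p q IHp IHq|p q IHp IHq].
- by rewrite poly_of_mpolyC mpoly_of_polyC mpoly_liftC.
- rewrite poly_of_mpolyX; case: unliftP => [k|] -> /=.
    by rewrite mpoly_of_polyC mpoly_liftX.
  by rewrite mpoly_of_polyX.
- by rewrite poly_of_mpolyD mpoly_of_polyD; congr (_ + _).
by rewrite poly_of_mpolyM mpoly_of_polyM; congr (_ * _).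
Qed.

Lemma poly_of_mpoly_lift a : poly_of_mpoly (mpoly_lift a) = a%:P.
Proof.
move: a; apply: mpoly_alg_ind => [c|j|p q IHp IHq|p q IHp IHq].
- by rewrite mpoly_liftC poly_of_mpolyC.
- by rewrite mpoly_liftX poly_of_mpolyX liftK.
- by rewrite mpoly_liftD poly_of_mpolyD polyCD; congr (_ + _).
by rewrite mpoly_liftM poly_of_mpolyM polyCM; congr (_ * _).
Qed.

Lemma mpoly_of_polyK : cancel mpoly_of_poly poly_of_mpoly.
Proof.
elim/poly_ind => [|q c IHq]; first by rewrite !rmorph0.
rewrite mpoly_of_polyD mpoly_of_polyM.
rewrite poly_of_mpolyD poly_of_mpolyM.
rewrite mpoly_of_polyC poly_of_mpoly_lift mpoly_of_polyX.
by rewrite poly_of_mpolyX unlift_none; congr (_ * _ + _).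
Qed.

Lemma mderiv_mpoly_lift a : (mpoly_lift a)^`M(i) = 0.
Proof.
rewrite (chain_rule _ _ _ mpoly_lift (mderiv i)).
- rewrite big1 // => j _; rewrite /= mpoly_liftX mderivXU.
  by rewrite eq_sym (negPf (neq_lift i j)) mulr0.
- exact: mderivD.
- exact: mderivM.
by move=> c; rewrite /= mpoly_liftC mderivC.
Qed.

End MainVariable.

Lemma mpoly_poly_iso (C : fieldType) (n : nat) (i : 'I_n.+1) :
  exists (phi : {rmorphism {mpoly C[n.+1]} -> {poly {mpoly C[n]}}})
    (psi : {rmorphism {poly {mpoly C[n]}} -> {mpoly C[n.+1]}}),
    [/\ cancel phi psi, cancel psi phi & forall a, (psi a%:P)^`M(i) = 0].
Proof.
exists (poly_of_mpoly C n i), (mpoly_of_poly C n i).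
split; [exact: poly_of_mpolyK | exact: mpoly_of_polyK | move=> a].
by rewrite -[RHS](mderiv_mpoly_lift C n i a) -mpoly_of_polyC.
Qed.

Lemma factorial_mpoly (C : fieldType) (n : nat) : factorial_ring {mpoly C[n]}.
Proof.
elim: n => [|n IHn].
  move=> a a0; apply: prime_product_unit.
  have aE := nvar0_mpolyC_eq a (erefl 0%N).
  by rewrite aE rmorph_unit // unitfE; apply: contraNneq a0 => a0; rewrite aE a0.
have [phi [psi [phiK psiK _]]] := mpoly_poly_iso C n ord_max.
exact: factorial_ring_iso psiK phiK (factorial_ring_poly _ IHn).
Qed.

(** [deg] is the size in the i-th variable, and [c] is a power of the leading coefficient of [g] in
    that variable. *)
Lemma mpoly_pseudo_division (C : fieldType) (n : nat) (i : 'I_n.+1) :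
  exists deg : {mpoly C[n.+1]} -> nat, forall f g, g != 0 ->
    exists c w r, [/\ c != 0, c^`M(i) = 0, c * f = w * g + r
      & (deg r < deg g)%N].
Proof.
have [phi [psi [phiK psiK psiC]]] := mpoly_poly_iso C n i.
exists (fun f => size (phi f)) => f g g0.
have phi_g : phi g != 0.
  by apply: contraNneq g0 => E; rewrite -[g]phiK E rmorph0.
exists (psi (lead_coef (phi g) ^+ scalp (phi f) (phi g))%:P).
exists (psi (phi f %/ phi g)), (psi (phi f %% phi g)).
split; last by rewrite psiK ltn_modp.
- apply: contraNneq (Pdiv.Idomain.lc_expn_scalp_neq0 (phi f) (phi g)) => E.
  by rewrite -polyC_eq0 -[X in X == 0]psiK E rmorph0.
- exact: psiC.
have := congr1 psi (Pdiv.Idomain.divp_eq (phi f) (phi g)).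
by rewrite -mul_polyC rmorphM rmorphD rmorphM !phiK.
Qed.

(** * Partial derivatives in characteristic zero *)

Section Derivatives.

Variables (C : fieldType) (n : nat).
Hypothesis C0 : [pchar C] =i pred0.
Implicit Types p : {mpoly C[n]}.

Lemma natr_C_neq0 k : k.+1%:R != 0 :> C.
Proof. by have /pcharf0P -> := C0. Qed.

Lemma msize_mderiv i p : p != 0 -> (msize p^`M(i) < msize p)%N.
Proof.
move=> p0; have [->|d0] := eqVneq p^`M(i) 0.
  by rewrite msize0 lt0n msize_poly_eq0.
rewrite -(mlead_deg d0).
have := mlead_supp d0; rewrite mcoeff_msupp mcoeff_deriv => H.
apply: (@leq_ltn_trans (mdeg (mlead p^`M(i) + U_(i))%MM)).
  by rewrite mdegD mdeg1 addn1.
apply: msize_mdeg_lt; rewrite mcoeff_msupp; apply: contraNneq H => ->.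
by rewrite mul0rn.
Qed.

(** A monomial containing the i-th variable survives in the i-th derivative, with its coefficient
    multiplied by a nonzero integer. *)
Lemma mderiv_eq0 p : (forall i, p^`M(i) = 0) -> p = (p@_0)%:MP.
Proof.
move=> dp; apply/mpolyP=> m; rewrite mcoeffC.
have [->|/eqP m0] := eqVneq m 0%MM; first by rewrite mulr1.
rewrite mulr0.
have [i mi] : exists i, (0 < m i)%N.
  apply: contrapT => nm; apply: m0; apply/mnmP=> i; rewrite mnm0E.
  by case E: (m i) => [//|k]; case: nm; exists i; rewrite E.
have := congr1 (mcoeff (m - U_(i))%MM) (dp i).
rewrite mcoeff_deriv mcoeff0 submK; last by rewrite lep1mP -lt0n.
by move/eqP; rewrite -mulr_natr mulf_eq0 (negPf (natr_C_neq0 _)) orbF => /eqP.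
Qed.

End Derivatives.

(** * Contraction of primes *)

Lemma exists_minimal (T : Type) (P : T -> Prop) (m : T -> nat) :
  (exists x, P x) -> exists x, P x /\ forall y, P y -> (m x <= m y)%N.
Proof.
case=> x0 Px0.
have exn : exists k, `[< exists x, P x /\ m x = k >].
  by exists (m x0); apply/asboolP; exists x0.
case: (ex_minnP exn) => k /asboolP[x [Px <-]] kmin; exists x; split=> // y Py.
by apply: kmin; apply/asboolP; exists y.
Qed.

(** [P] stands for membership in a prime ideal, later the contraction of a prime of the larger
    ring. *)
Lemma prime_product_prime_factor {R : idomainType} (P : R -> Prop) a :
  (forall u, u \is a GRing.unit -> ~ P u) ->
  (forall x y, P (x * y) -> P x \/ P y) ->
  prime_product a -> P a ->
  exists p, [/\ prime_element p, P p & divides p a].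
Proof.
move=> Pu PM; elim=> [u uu /Pu //|p b pp _ IH /PM[Pp|/IH [r [rp Pr rb]]]].
  by exists p; split=> //; exists b.
by exists r; split=> //; apply: divides_mull.
Qed.

Lemma sqr_divides {R : idomainType} (a b c : R) :
  prime_product b -> a ^+ 2 = b ^+ 2 * c -> divides b a.
Proof.
move=> pb; elim: pb a => [u uu|p d pp _ IH] a aE.
  by exists (u^-1 * a); rewrite mulrA mulrV // mul1r.
case: (pp) => p0 _ pP.
have : divides p (a * a).
  by rewrite -expr2 aE exprMn -mulrA expr2 -mulrA; exists (p * (d ^+ 2 * c)).
have pa : divides p (a * a) -> divides p a by move/pP => [].
move=> /pa [a' aE'].
have [|e eE] := IH a'.
  apply: (mulfI (expf_neq0 2 p0)); rewrite -exprMn -aE' aE exprMn.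
  by rewrite mulrA.
by exists e; rewrite aE' eE mulrA.
Qed.

(** * Polynomial rings mapped to a factorial ring to which the partial derivatives extend *)

Section Etale.

Variables (C : fieldType) (n : nat) (S : idomainType).
Hypothesis C0 : [pchar C] =i pred0.
Hypothesis US : factorial_ring S.
Variable F : {rmorphism {mpoly C[n.+1]} -> S}.
Variable D : 'I_n.+1 -> S -> S.
Hypothesis DM : forall j a b, D j (a * b) = D j a * b + a * D j b.
Hypothesis DF : forall j f, D j (F f) = F f^`M(j).
Hypothesis SU : forall u : S, u \is a GRing.unit -> exists c, u = F c%:MP.

Lemma const_unit (c : C) : c != 0 -> (c%:MP : {mpoly C[n.+1]}) \is a GRing.unit.
Proof. by move=> c0; rewrite rmorph_unit // unitfE. Qed.

(** The kernel is stable under the partial derivatives. By induction on size these vanish on a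
    kernel element, which is then a constant; a nonzero constant maps to a unit. *)
Lemma etale_inj : injective F.
Proof.
suff Fg0 g : F g = 0 -> g = 0.
  move=> f g fg; apply/eqP; rewrite -subr_eq0; apply/eqP/Fg0.
  by rewrite rmorphB fg subrr.
move: {2}(msize g) (leqnn (msize g)) => k.
elim: k g => [|k IHk] g szg Fg0.
  by apply/eqP; rewrite -msize_poly_eq0 -leqn0.
have [//|g0] := eqVneq g 0.
have /(mderiv_eq0 _ _ C0) gE : forall i, g^`M(i) = 0.
  move=> i; apply: IHk; first by rewrite -ltnS (leq_trans _ szg) ?msize_mderiv.
  (* [D i 0 = 0] comes from the Leibniz rule for [0 * 0]. *)
  by rewrite -DF Fg0; have := DM i 0 0; rewrite !mulr0 mul0r addr0.
have : F g \is a GRing.unit.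
  apply: rmorph_unit; rewrite gE; apply: const_unit.
  by apply: contraNneq g0 => g0; rewrite gE g0.
by rewrite Fg0 unitr0.
Qed.

Lemma etale_neq0 f : f != 0 -> F f != 0.
Proof. by apply: contraNneq => Ff0; apply/eqP/etale_inj; rewrite Ff0 rmorph0. Qed.

Lemma msize_lt_mul (p g : {mpoly C[n.+1]}) :
  p != 0 -> p \isn't a GRing.unit -> g != 0 -> (msize g < msize (p * g))%N.
Proof.
move=> p0 pu g0; rewrite msizeM // (mpolySpred _ p0) addSn /=.
rewrite -[X in (X < _)%N]add0n ltn_add2r lt0n.
apply: contraNneq pu => szp.
have /msize1_polyC pE : (msize p <= 1)%N by rewrite (mpolySpred _ p0) szp.
by rewrite pE; apply: const_unit; apply: contraNneq p0 => E0; rewrite pE E0.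
Qed.

Section Prime.

Variable q : S.
Hypothesis qP : prime_element q.

Local Notation P f := (divides q (F f)).

Let P_unit f : f \is a GRing.unit -> ~ P f.
Proof.
move=> /(rmorph_unit F) fu qf; case: qP => _ + _.
by rewrite (divides_unit _ _ qf fu).
Qed.

Let P_mul f g : P (f * g) -> P f \/ P g.
Proof. by rewrite rmorphM; case: qP => _ _; apply. Qed.

(* Up to multiples of q, the derivation p_i d_j - p_j d_i of C[F] kills both
   p and q, so it preserves P. On elements r with r_i = 0 it acts as p_i d_j,
   and p_i lies outside the prime P, so P contains every derivative of r. *)
Lemma contraction_main_variable i p : P p -> ~ P p^`M(i) ->
  forall r, P r -> r^`M(i) = 0 -> r = 0.
Proof.
move=> [u pE] npi r; move: {2}(msize r) (leqnn (msize r)) => k.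
elim: k r => [|k IHk] r szr Pr ri.
  by apply/eqP; rewrite -msize_poly_eq0 -leqn0.
have [//|r0] := eqVneq r 0.
have rE : r = (r@_0)%:MP.
  apply: (mderiv_eq0 _ _ C0) => j; apply: IHk.
  - by rewrite -ltnS (leq_trans _ szr) ?msize_mderiv.
  - have [w wE] := Pr.
    have : P (p^`M(i) * r^`M(j) - p^`M(j) * r^`M(i)).
      rewrite rmorphB !rmorphM -!DF pE wE !DM.
      (* In the expansion of [D i (q * u) * D j (q * w) - D j (q * u) * D i (q * w)] the two terms
         without an explicit factor [q] cancel. *)
      exists ((D i u * D j q - D j u * D i q) * w
        + (D i q * u + q * D i u) * D j w - (D j q * u + q * D j u) * D i w).
      ring.
    by rewrite ri mulr0 subr0 => /P_mul [].
  by rewrite mderiv_comm ri mderiv0.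
case: (P_unit r) => //; rewrite rE; apply: const_unit.
by apply: contraNneq r0 => r0; rewrite rE r0.
Qed.

(** The generator is a prime factor, lying in [P], of a nonzero element of [P] of least size. Some
    derivative of it lies outside [P], which forbids a second factor [q] and makes
    [contraction_main_variable] available. *)
Lemma contraction_principal p0 : p0 != 0 -> P p0 ->
  exists p u, [/\ prime_element p, F p = q * u, ~ divides q u
    & forall f, P f -> divides p f].
Proof.
move=> p00 Pp0.
have [p1 [[p10 Pp1] p1min]] := @exists_minimal _ (fun f => f != 0 /\ P f)
  (fun f => msize f) (ex_intro _ p0 (conj p00 Pp0)).
have [p [pp Pp [c p1E]]] := prime_product_prime_factor (fun f => P f) p1
  P_unit P_mul (factorial_mpoly C n.+1 p1 p10) Pp1.
case: (pp) => pn0 pu pP.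
have pmin f : f != 0 -> P f -> (msize p <= msize f)%N.
  move=> f0 Pf; apply: leq_trans (p1min f (conj f0 Pf)).
  have c0 : c != 0 by apply: contraNneq p10 => c0; rewrite p1E c0 mulr0.
  rewrite p1E msizeM // (mpolySpred _ c0) addnS /=; exact: leq_addr.
(* A derivative of [p] lying in [P] must vanish, being smaller than [p]; if all did, [p] would be
   constant. *)
have [i npi] : exists i, ~ P p^`M(i).
  apply: contrapT => npi; have pE : p = (p@_0)%:MP.
    apply: (mderiv_eq0 _ _ C0) => i; apply/eqP/negPn/negP=> di0.
    have := msize_mderiv _ _ i p pn0; rewrite ltnNge pmin //.
    by apply: contrapT => nP; apply: npi; exists i.
  case/negP: pu; rewrite pE; apply: const_unit.
  by apply: contraNneq pn0 => pn0; rewrite pE pn0.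
have [u pE] := Pp; exists p, u.
have noc := contraction_main_variable i p Pp npi.
split=> //.
  (* If [q ^+ 2] divided [F p], the Leibniz rule would put the i-th derivative of [p] in [P]. *)
  case=> u' uE; apply: npi; rewrite -DF pE uE !DM.
  by exists (D i q * u' + (D i q * u' + q * D i u')); ring.
(* Some p2 in P of least degree in the i-th variable divides every element
   of P up to a factor free of that variable, and such factors are not in P. *)
have [deg degP] := mpoly_pseudo_division C n i.
have [p2 [[p20 Pp2] p2min]] := @exists_minimal _ (fun f => f != 0 /\ P f)
  deg (ex_intro _ p0 (conj p00 Pp0)).
have pseudo f : P f -> exists d w, [/\ d != 0, d^`M(i) = 0 & d * f = w * p2].
  move=> Pf; have [d [w [r [d0 di E degr]]]] := degP f p2 p20.
  exists d, w; split=> //; rewrite E; suff -> : r = 0 by rewrite addr0.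
  apply/eqP/negPn/negP => r0; move: degr; rewrite ltnNge p2min //; split=> //.
  rewrite (_ : r = d * f - w * p2); last by rewrite E addrC addKr.
  by rewrite rmorphB !rmorphM; apply: dividesB; apply: divides_mull.
have Pdiv f g : divides f g -> P f -> P g.
  by case=> h -> Pf; rewrite rmorphM; apply: divides_mulr.
(* In [d * p = w * p2], if [p] divided [w], cancelling it would make [d] a multiple of [p2]. Then
   [d] would be a nonzero element of [P] free of the i-th variable. *)
have pp2 : divides p p2.
  have [d [w [d0 di E]]] := pseudo _ Pp.
  have /pP[[w' wE]|//] : divides p (w * p2) by rewrite -E; exists d; rewrite mulrC.
  case/eqP: d0; apply: noc => //; apply: Pdiv Pp2; exists w'.
  by apply: (mulfI pn0); rewrite mulrC E wE; ring.
move=> f /pseudo[d [w [d0 di E]]].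
have /pP[dp|//] : divides p (d * f) by rewrite E; apply: divides_mull.
by case/eqP: d0; apply: noc => //; apply: Pdiv Pp.
Qed.

End Prime.

(** A prime [q] dividing [F g] also divides [F f], so the generator of its contraction divides both
    [g] and [f]. It is cancelled, and the induction ends when [F g] is a unit, hence [g] a
    constant. *)
Lemma etale_divides f g : g != 0 -> divides (F g) (F f) -> divides g f.
Proof.
move: {2}(msize g) (leqnn (msize g)) => k.
elim: k f g => [|k IHk] f g szg g0 Fgf.
  by move: g0; rewrite -msize_poly_eq0 -leqn0 szg.
have := US _ (etale_neq0 _ g0); move E: (F g) => a pa; case: a / pa E => [u uu E|q a qP _ E].
  have [c] := SU _ uu; rewrite -E => /etale_inj gE.
  exists (c^-1%:MP * f); rewrite mulrA gE -mpolyCM mulfV ?mpolyC1 ?mul1r //.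
  by apply: contraNneq g0 => c0; rewrite gE c0.
have qg : divides q (F g) by exists a.
have [p [u [pp pE _ pd]]] := contraction_principal q qP g g0 qg.
have [g' gE] := pd _ qg.
have [f' fE] := pd _ (divides_trans _ _ _ qg Fgf).
have pn0 : p != 0 by case: pp.
have g'0 : g' != 0 by apply: contraNneq g0 => g'0; rewrite gE g'0 mulr0.
have [||e eE] := IHk f' g' _ g'0.
- rewrite -ltnS; apply: leq_trans szg; rewrite gE; apply: msize_lt_mul => //.
  by case: pp.
- case: Fgf => h; rewrite fE gE !rmorphM -mulrA => /(mulfI (etale_neq0 _ pn0)) hE.
  by exists h.
by exists e; rewrite fE eE gE mulrA.
Qed.

(** For a prime [q] dividing [s], the generator [p] of its contraction divides [d] twice. Then [F p]
    divides [s], and the quotient has a smaller square. *)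
Lemma etale_sqrt s d : s ^+ 2 = F d -> exists h, s = F h.
Proof.
move: {2}(msize d) (leqnn (msize d)) => k.
elim: k s d => [|k IHk] s d szd sE.
  exists 0; apply/eqP; rewrite rmorph0 -sqrf_eq0 sE.
  by move: szd; rewrite leqn0 msize_poly_eq0 => /eqP->; rewrite rmorph0.
have [s0|s0] := eqVneq s 0; first by exists 0; rewrite rmorph0.
have := US _ s0; move E: s => a pa; case: a / pa E => [u uu E|q a qP _ E].
  by have [c ->] := SU _ uu; exists c%:MP.
have d0 : d != 0.
  by apply: contraNneq s0 => d0; rewrite -sqrf_eq0 sE d0 rmorph0.
have qd : divides q (F d) by rewrite -sE E; exists (a * (q * a)); ring.
have [p [u [pp pE nqu pd]]] := contraction_principal q qP d d0 qd.
have [d' dE] := pd _ qd.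
have q0 : q != 0 by case: qP.
(* [q ^+ 2] divides [F d = F p * F d'] while [F p] contains [q] only once, so [q] divides [F d']. *)
have [d'' dE'] : divides p d'.
  apply: pd; have : divides q (u * F d').
    exists (a ^+ 2); apply: (mulfI q0); rewrite mulrA -pE -rmorphM -dE -sE E.
    ring.
  by case: qP => _ _ /[apply] -[].
have pn0 : p != 0 by case: pp.
have Fp0 := etale_neq0 _ pn0.
have [t tE] : divides (F p) s.
  apply: (@sqr_divides _ _ _ (F d'')); first exact: US.
  by rewrite sE dE dE' !rmorphM mulrA.
have tE2 : t ^+ 2 = F d''.
  apply: (mulfI (expf_neq0 2 Fp0)); rewrite -exprMn -tE sE dE dE' !rmorphM mulrA //.
have [|h hE] := IHk t d'' _ tE2; last by exists (p * h); rewrite -E tE hE rmorphM.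
have pu : p \isn't a GRing.unit by case: pp.
have d'0 : d' != 0 by apply: contraNneq d0 => d'0; rewrite dE d'0 mulr0.
have d''0 : d'' != 0 by apply: contraNneq d'0 => d''0; rewrite dE' d''0 mulr0.
rewrite -ltnS; apply: leq_trans szd; rewrite dE.
apply: leq_trans (msize_lt_mul _ _ pn0 pu d'0); rewrite ltnS dE' ltnW //.
exact: msize_lt_mul.
Qed.

End Etale.

(** * Keller maps *)

Lemma clear_denominators (L : fieldType) (x f1 g1 f2 g2 : L) :
  g1 != 0 -> g2 != 0 ->
  g1 * g2 * x ^+ 2 + f1 * g2 * x + f2 * g1
    = g1 * g2 * (x ^+ 2 + f1 / g1 * x + f2 / g2).
Proof. by move=> g10 g20; field; apply/andP; split. Qed.

(** In column [i] only the diagonal entry can be nonzero, and its minor is the identity. This is the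
    determinant behind Cramer's rule. *)
Lemma det_row_replaced (S : comNzRingType) (m : nat) (i : 'I_m.+1)
    (r : 'rV[S]_m.+1) :
  \det (\matrix_(k, l) if k == i then r 0 l else (k == l)%:R) = r 0 i.
Proof.
rewrite (expand_det_col _ i) (bigD1 i) //= big1 => [|k ki]; last first.
  by rewrite mxE (negPf ki) mul0r.
rewrite mxE eqxx addr0 /cofactor addnn -mul2n exprM sqrrN expr1n expr1n mul1r.
rewrite (_ : row' _ _ = 1%:M) ?det1 ?mulr1 //.
apply/matrixP=> k l; rewrite !mxE eq_sym (negPf (neq_lift i k)).
by rewrite (inj_eq lift_inj).
Qed.

Section Keller.

Variables (C : fieldType) (n : nat).
Hypothesis C0 : [pchar C] =i pred0.
Variable F : {rmorphism {mpoly C[n.+1]} -> {mpoly C[n.+1]}}.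
Hypothesis morphC : forall c, F c%:MP = c%:MP.

Let J := \matrix_(i < n.+1, l < n.+1) mderiv l (F 'X_i).

Variable c : C.
Hypothesis c0 : c != 0.
Hypothesis detJ : \det J = c%:MP.

Lemma chain_rule_endo l f :
  (F f)^`M(l) = \sum_i F f^`M(i) * (F 'X_i)^`M(l).
Proof.
apply: (chain_rule _ _ _ F (mderiv l)); [exact: mderivD|exact: mderivM|].
by move=> d; rewrite morphC mderivC.
Qed.

(* The derivation d/dF_j of C[F], extended to C[x]. *)
Definition dual_derivation j w := \sum_l w^`M(l) * invmx J l j.

Lemma dual_derivationM j a b : dual_derivation j (a * b) =
  dual_derivation j a * b + a * dual_derivation j b.
Proof.
rewrite /dual_derivation mulr_suml mulr_sumr -big_split; apply: eq_bigr => l _.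
rewrite mderivM /=; ring.
Qed.

Lemma dual_derivationF j f : dual_derivation j (F f) = F f^`M(j).
Proof.
have Ju : J \in unitmx by rewrite unitmxE detJ rmorph_unit // unitfE.
pose r := \row_i F f^`M(i); have rE : r = \row_l (F f)^`M(l) *m invmx J.
  rewrite -[LHS](mulmxK Ju); congr (_ *m _); apply/rowP=> l.
  by rewrite !mxE chain_rule_endo; apply: eq_bigr => i _; rewrite !mxE.
have := congr1 (fun M : 'rV__ => M 0 j) rE; rewrite !mxE => ->.
by apply: eq_bigr => l _; rewrite mxE.
Qed.

Lemma unit_const (u : {mpoly C[n.+1]}) :
  u \is a GRing.unit -> exists d, u = F d%:MP.
Proof. by move=> /andP[/eqP uE _]; exists u@_0; rewrite morphC. Qed.

Lemma keller_inj : injective F.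
Proof. exact: (etale_inj _ _ _ C0 F _ dual_derivationM dual_derivationF). Qed.

Definition in_image y := exists h, y = F h.

(** This is the equality of C[F] with the intersection of C(F) and C[x]. *)
Lemma in_image_div y f g : g != 0 -> F g * y = F f -> in_image y.
Proof.
move=> g0 E; have [h hE] : divides g f.
  apply: (etale_divides _ _ _ C0 (factorial_mpoly _ _) F _ dual_derivationM
    dual_derivationF unit_const) => //; by exists y.
exists h; apply: (mulfI (_ : F g != 0)); last by rewrite E hE rmorphM.
by apply: contraNneq g0 => Fg0; apply/eqP/keller_inj; rewrite Fg0 rmorph0.
Qed.

Lemma in_image_sqrt s d : s ^+ 2 = F d -> in_image s.
Proof.
exact: (etale_sqrt _ _ _ C0 (factorial_mpoly _ _) F _ dual_derivationM
    dual_derivationF unit_const).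
Qed.

(** Completing the square: with [F] omitted, [2gy + b] has square [b^2 - 4gh], so it lies in the
    image, and [y] follows by dividing by [2g]. *)
Lemma in_image_quadratic y g b h : g != 0 ->
  F g * y ^+ 2 + F b * y + F h = 0 -> in_image y.
Proof.
move=> g0 E.
have [s sE] : in_image (F g * 2%:R * y + F b).
  apply: (@in_image_sqrt _ (b ^+ 2 - g * h * 4%:R)).
  rewrite rmorphB rmorphXn !rmorphM rmorph_nat.
  apply/eqP; rewrite -subr_eq0; apply/eqP.
  transitivity (F g * 4%:R * (F g * y ^+ 2 + F b * y + F h)); first ring.
  by rewrite E mulr0.
apply: (@in_image_div y (s - b) (g * 2%:R)).
  rewrite mulf_neq0 // -mpolyC_nat mpolyC_eq0; exact: natr_C_neq0.
by rewrite rmorphM rmorph_nat rmorphB -sE addrK.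
Qed.

Lemma image_field_fraction z :
  generated_subfield (fun z : ratfrac C n.+1 =>
    (exists c, z = to_ratfrac c%:MP) \/
    (exists i, z = to_ratfrac (F 'X_i))) z ->
  exists f g, g != 0 /\ z = to_ratfrac (F f) / to_ratfrac (F g).
Proof.
have F0 g : g != 0 -> to_ratfrac (F g) != 0.
  move=> g0; rewrite tofrac_eq0; apply: contraNneq g0 => Fg0.
  by apply/eqP/keller_inj; rewrite Fg0 rmorph0.
have one : to_ratfrac (F 1) = 1 by rewrite rmorph1 /to_ratfrac rmorph1.
elim=> [{}z [[d ->]|[i ->]]||y {}z _ [f1 [g1 [g10 ->]]] _ [f2 [g2 [g20 ->]]]
       |y {}z _ [f1 [g1 [g10 ->]]] _ [f2 [g2 [g20 ->]]]].
- by exists d%:MP, 1; rewrite oner_neq0 one divr1 morphC.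
- by exists 'X_i, 1; rewrite oner_neq0 one divr1.
- by exists 1, 1; rewrite oner_neq0 one divr1.
- exists (f1 * g2 - f2 * g1), (g1 * g2); split; first exact: mulf_neq0.
  rewrite -mulNr addf_div ?F0 // mulNr.
  by rewrite rmorphB !rmorphM /to_ratfrac rmorphB !rmorphM.
(* Division by zero gives zero, represented as [0 / 1]. *)
have [->|f20] := eqVneq f2 0.
  by exists 0, 1; rewrite oner_neq0 rmorph0 /to_ratfrac tofrac0 !mul0r invr0 mulr0.
exists (f1 * g2), (g1 * f2); split; first exact: mulf_neq0.
by rewrite invf_div mulf_div !rmorphM /to_ratfrac !rmorphM.
Qed.

Lemma in_image_deg2 y (m : {poly ratfrac C n.+1}) :
  is_minimal_polynomial (generated_subfield (fun z : ratfrac C n.+1 =>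
    (exists c, z = to_ratfrac c%:MP) \/
    (exists i, z = to_ratfrac (F 'X_i)))) (to_ratfrac y) m ->
  ((size m).-1 <= 2)%N -> in_image y.
Proof.
move=> [mM mK my _] szm; set K := generated_subfield _ in mK.
have K0 : K 0 by rewrite -(subrr 1); apply: gen_sub; apply: gen_one.
have [a [b [Ka Kb E]]] : exists a b, [/\ K a, K b &
    to_ratfrac y ^+ 2 + a * to_ratfrac y + b = 0].
  move: mM my; rewrite monicE lead_coefE rootE horner_coef.
  case E: (size m) szm => [|[|[|[|s]]]] // _ /eqP lc.
  - by move: (size_poly_leq0 m); rewrite E leqnn => /esym/eqP m0;
      move/eqP: lc; rewrite m0 coef0 eq_sym oner_eq0.
  - by rewrite big_ord1 expr0 mulr1 lc oner_eq0.
  - rewrite big_ord_recl big_ord1 expr0 mulr1 lc mul1r => /eqP my.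
    (* A linear equation is multiplied by its root to become quadratic. *)
    by exists m`_0, 0; split=> //; rewrite addr0 expr2 -mulrDl addrC my mul0r.
  - rewrite 2!big_ord_recl big_ord1 expr0 mulr1 lc mul1r => /eqP my.
    exists m`_1, m`_0; split=> //; rewrite -[RHS]my /=.
    by rewrite [RHS]addrC [X in _ = X + _]addrC.
have [f1 [g1 [g10 aE]]] := image_field_fraction a Ka.
have [f2 [g2 [g20 bE]]] := image_field_fraction b Kb.
have F0 g : g != 0 -> to_ratfrac (F g) != 0.
  move=> g0; rewrite tofrac_eq0; apply: contraNneq g0 => Fg0.
  by apply/eqP/keller_inj; rewrite Fg0 rmorph0.
apply: (in_image_quadratic y (g1 * g2) (f1 * g2) (f2 * g1)).
  exact: mulf_neq0.
apply/eqP; rewrite -tofrac_eq0 -/(to_ratfrac _); apply/eqP.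
transitivity (to_ratfrac (F g1) * to_ratfrac (F g2) *
  (to_ratfrac y ^+ 2 + a * to_ratfrac y + b)); last by rewrite E mulr0.
rewrite aE bE -clear_denominators ?F0 // !rmorphM /to_ratfrac !tofracD.
by rewrite [FracField.tofrac (_ * y ^+ 2)]tofracM tofracXn !tofracM.
Qed.

Lemma in_imageD y z : in_image y -> in_image z -> in_image (y + z).
Proof. by move=> [f ->] [g ->]; exists (f + g); rewrite rmorphD. Qed.

Lemma in_imageM y z : in_image y -> in_image z -> in_image (y * z).
Proof. by move=> [f ->] [g ->]; exists (f * g); rewrite rmorphM. Qed.

Lemma in_imageC d : in_image d%:MP.
Proof. by exists d%:MP; rewrite morphC. Qed.

(** Substituting preimages of the variables gives a right inverse; injectivity makes it
    two-sided. *)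
Lemma keller_bijective : (forall j, in_image 'X_j) -> bijective F.
Proof.
move=> /fin_all_exists[G GX].
have morphX m : F (mmap (@mpolyC n.+1 C) G m) = m.
  move: m; apply: mpoly_alg_ind => [d|i|p q IHp IHq|p q IHp IHq].
  - by rewrite mmapC morphC.
  - by rewrite mmapX mmap1U -GX.
  - by rewrite mmapD rmorphD; congr (_ + _).
  by rewrite (rmorphM (mmap (@mpolyC n.+1 C) G)) rmorphM; congr (_ * _).
exists (mmap (@mpolyC n.+1 C) G); last exact: morphX.
by move=> f; apply: keller_inj; rewrite morphX.
Qed.

(** * Recovering the one remaining variable *)

Section LastVariable.

Variable i0 : 'I_n.+1.
Hypothesis in_imageX : forall k, k != i0 -> in_image 'X_k.

Lemma in_image_mderivF m : in_image (F 'X_m)^`M(i0).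
Proof.
have /fin_all_exists[G GX] : forall k, exists g, k != i0 -> 'X_k = F g.
  move=> k; have [ki|ki] := eqVneq k i0; first by exists 0.
  by have [g gE] := in_imageX k ki; exists g.
(* Row [i0] of [map_mx F N *m J] is the gradient of [F 'X_m]. Any other row [k] is the gradient of
   ['X_k = F (G k)], a row of the identity. The determinant is therefore the desired derivative. *)
pose N := \matrix_(k < n.+1, j < n.+1)
  if k == i0 then (j == m)%:R else (G k)^`M(j).
have NJ : map_mx F N *m J
    = \matrix_(k, l) if k == i0 then (\row_l' (F 'X_m)^`M(l')) 0 l
                     else (k == l)%:R.
  apply/matrixP=> k l; rewrite !mxE; case: (eqVneq k i0) => [->|ki].
    rewrite (bigD1 m) //= big1 => [|j jm].
      by rewrite !mxE !eqxx rmorph1 mul1r addr0.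
    by rewrite !mxE eqxx (negPf jm) rmorph0 mul0r.
  rewrite -mderivXU GX // chain_rule_endo; apply: eq_bigr => j _.
  by rewrite !mxE (negPf ki).
have := congr1 determinant NJ; rewrite det_mulmx det_row_replaced mxE => <-.
rewrite detJ det_map_mx; apply: in_imageM; last exact: in_imageC.
by exists (\det N).
Qed.

Lemma in_image_mderiv y : in_image y -> in_image y^`M(i0).
Proof.
move=> [h ->]; rewrite chain_rule_endo; apply: big_ind => [||i _].
- by rewrite -mpolyC0; apply: in_imageC.
- exact: in_imageD.
apply: in_imageM; last exact: in_image_mderivF.
by exists h^`M(i).
Qed.

Lemma in_image_mderiv_eq0 y : y^`M(i0) = 0 -> in_image y.
Proof.
move=> yi; rewrite [y]mpolyE big_seq; apply: big_ind => [||m my].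
- by rewrite -mpolyC0; apply: in_imageC.
- exact: in_imageD.
rewrite -mul_mpolyC; apply: in_imageM; first exact: in_imageC.
(* In characteristic zero the vanishing derivative excludes ['X_i0] from every monomial of [y]. *)
have mi : m i0 = 0%N.
  case E: (m i0) => [//|k]; move: my; rewrite mcoeff_msupp => /eqP[].
  have := congr1 (mcoeff (m - U_(i0))%MM) yi.
  rewrite mcoeff_deriv mcoeff0 submK; last by rewrite lep1mP E.
  by move/eqP; rewrite -mulr_natr mulf_eq0 (negPf (natr_C_neq0 _ C0 _)) orbF => /eqP.
rewrite mpolyXE_id; apply: big_ind => [||i _].
- by rewrite -mpolyC1; apply: in_imageC.
- exact: in_imageM.
have [->|ii0] := eqVneq i i0.
  by rewrite mi expr0 -mpolyC1; apply: in_imageC.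
elim: (m i) => [|k IHk]; first by rewrite expr0 -mpolyC1; apply: in_imageC.
by rewrite exprS; apply: in_imageM => //; apply: in_imageX.
Qed.

Lemma in_image_last : in_image 'X_i0.
Proof.
have [y [yF y1 y2]] :
    exists y, [/\ in_image y, y^`M(i0) != 0 & y^`M(i0)^`M(i0) = 0].
  (* Otherwise column [i0] of [J] would be zero. *)
  have [m mF] : exists m, (F 'X_m)^`M(i0) != 0.
    apply: contrapT => nm; have : \det J = 0.
      rewrite (expand_det_col _ i0) big1 // => k _; rewrite mxE.
      have -> : (F 'X_k)^`M(i0) = 0; last by rewrite mul0r.
      by apply/eqP/negPn/negP => Fk; apply: nm; exists k.
    by rewrite detJ => /eqP; rewrite mpolyC_eq0 (negPf c0).
  have : in_image (F 'X_m) by exists 'X_m.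
  move: (F 'X_m) mF => y; move: {2}(msize y) (leqnn (msize y)) => k.
  elim: k y => [|k IHk] y szy y1 yF.
    by move: szy y1; rewrite leqn0 msize_poly_eq0 => /eqP->; rewrite mderiv0 eqxx.
  have [y2|y2] := eqVneq y^`M(i0)^`M(i0) 0; first by exists y.
  apply: IHk y2 _; last exact: in_image_mderiv.
  rewrite -ltnS; apply: leq_trans szy; apply: msize_mderiv.
  by apply: contraNneq y1 => ->; rewrite mderiv0.
have [a aE] := in_image_mderiv _ yF.
have [b bE] : in_image (y - y^`M(i0) * 'X_i0).
  apply: in_image_mderiv_eq0.
  by rewrite mderivB mderivM y2 mul0r add0r mderivXU eqxx mulr1 subrr.
have [f fE] := yF.
(* The derivative [F a] of [y] need not be a scalar, so ['X_i0] is obtained as the quotient of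
   [F (f - b)] by [F a]. *)
apply: (@in_image_div _ (f - b) a).
  by apply: contraNneq y1 => a0; rewrite aE a0 rmorph0.
by rewrite rmorphB -aE -bE -fE opprB addrC subrK.
Qed.

End LastVariable.

End Keller.

Theorem theorem4p1 (R : realType) (n : nat) (n_gt0 : (0 < n)%N)
    (F : {lrmorphism {mpoly R[i][n]} -> {mpoly R[i][n]}})
    (F_jac : invertible_jacobian F)
    (F_deg : exists2 A : {set 'I_n}, #|A| = (n - 1)%N &
      forall j : 'I_n, j \in A ->
        exists2 m : {poly ratfrac R[i] n},
          is_minimal_polynomial (image_field F) (to_ratfrac 'X_j) m &
          ((size m).-1 <= 2)%N) :
  bijective F.
Proof.
case: n n_gt0 F F_jac F_deg => [//|n] _ F [c c0 detJ] [A cardA F_deg].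
have C0 : [pchar R[i]] =i pred0 by exact: Num.Theory.pchar_num.
have morphC d : F d%:MP = d%:MP.
  by rewrite -[d%:MP]mulr1 mul_mpolyC linearZ rmorph1.
have imA j : j \in A -> in_image _ _ F 'X_j.
  move=> /F_deg[m mP szm].
  exact: (in_image_deg2 _ _ C0 F morphC c c0 detJ _ m mP szm).
have /eqP/cards1P[i0 Ai0] : #|~: A| = 1%N.
  by rewrite cardsCs setCK cardA card_ord subSS subn0 subSnn.
have imX k : k != i0 -> in_image _ _ F 'X_k.
  by move=> ki; apply: imA; rewrite -[A]setCK Ai0 !inE.
apply: (keller_bijective _ _ C0 F morphC c c0 detJ) => j.
have [->|/imX//] := eqVneq j i0.
exact: (in_image_last _ _ C0 F morphC c c0 detJ i0 imX).
Qed.
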